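(* Let $Q_t(n)$ be the number in system of an infinite server batch arrival queue with arrival rate $\lambda>0$, batch size $n\in\mathbb{Z}^+$, and exponential service rate $\mu>0$. Then the steady-state distribution $p_j=\mathbb{P}(Q_\infty(n)=j)$ is given by the recursion $$p_j=\sum_{i=1}^n i\,p_{j-i}\,\frac{\lambda}{ij\mu}=\sum_{i=1}^n p_{j-i}\,\frac{\lambda}{j\mu},\qquad j\ge 1,$$ where $p_0=e^{-\frac{\lambda}{\mu}H_n}$, $H_n=\sum_{k=1}^n\frac1k$ is the $n$-th harmonic number, and $p_k=0$ for all $k<0$.
   Context: Model: batches of exactly $n$ customers arrive at the epochs of a Poisson process of rate $\lambda$. There are infinitely many servers, so each customer starts service immediately and leaves after an independent $\mathrm{Exp}(\mu)$ service time. The number in system $Q_t(n)$ is thus the continuous-time Markov chain on $\{0,1,2,\dots\}$ with transitions $q\to q+n$ at rate $\lambda$ and $q\to q-1$ at rate $\mu q$. $Q_\infty(n)$ has the limiting distribution of $Q_t(n)$ as $t\to\infty$. *)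

(* Defs.v *)
From HB Require Import structures.
From mathcomp Require Import all_boot all_order all_algebra.
From mathcomp Require Import all_classical all_reals all_analysis.

Set Implicit Arguments.
Unset Strict Implicit.
Unset Printing Implicit Defensive.

Import Order.TTheory GRing.Theory Num.Theory.
Import numFieldNormedType.Exports.

Local Open Scope classical_set_scope.
Local Open Scope ring_scope.

Definition transition_function (R : realType) (p : R -> nat -> nat -> R) : Prop :=
  [/\ forall (t : R) i j, 0 <= t -> 0 <= p t i j,
      forall (t : R) i, 0 <= t -> (\sum_(0 <= j <oo) (p t i j)%:E = 1)%E,
      forall i j, p 0 i j = (i == j)%:R
    & forall (s t : R) i j, 0 <= s -> 0 <= t ->
        (\sum_(0 <= k <oo) (p s i k * p t k j)%:E = (p (s + t) i j)%:E)%E ].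

Definition has_generator (R : realType) (p : R -> nat -> nat -> R)
    (g : nat -> nat -> R) : Prop :=
  forall i j, (p h i j - (i == j)%:R) / h @[h --> 0^'+] --> g i j.

(* The Markov property of [Q] relative to its own history: the list [past]
   prescribes the values of [Q] at finitely many times in [0, t]. *)
Definition markov_property (R : realType) (d : measure_display)
    (Omega : measurableType d) (P : probability Omega R)
    (Q : R -> {RV P >-> nat}) (p : R -> nat -> nat -> R) : Prop :=
  forall (past : seq (R * nat)) (t s : R) (i j : nat),
    0 <= t -> 0 <= s -> all (fun x : R * nat => 0 <= x.1 <= t) past ->
    let H := [set w | all (fun x => Q x.1 w == x.2) past] in
    P (H `&` [set w | Q t w = i] `&` [set w | Q (t + s) w = j]) =
    (P (H `&` [set w | Q t w = i]) * (p s i j)%:E)%E.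

(* Time is [0, +oo[: [Q t] is unconstrained for t < 0. The initial law (that of
   [Q 0]) is arbitrary. *)
Definition continuous_time_markov_chain (R : realType) (d : measure_display)
    (Omega : measurableType d) (P : probability Omega R)
    (Q : R -> {RV P >-> nat}) (g : nat -> nat -> R) : Prop :=
  exists p : R -> nat -> nat -> R,
    [/\ transition_function p, has_generator p g & markov_property Q p].

(* The three cases are mutually exclusive because 0 < n. *)
Definition batch_queue_generator (R : realType) (lambda mu : R) (n : nat)
    (q r : nat) : R :=
  if r == (q + n)%N then lambda
  else if r.+1 == q then mu * q%:R
  else if r == q then - (lambda + mu * q%:R)
  else 0.

Definition limiting_distribution (R : realType) (d : measure_display)
    (Omega : measurableType d) (P : probability Omega R)
    (Q : R -> {RV P >-> nat}) (nu : probability nat R) : Prop :=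
  forall j : nat, distribution P (Q t) [set j] @[t --> +oo] --> nu [set j].

(* The probability that a variable of law [nu] equals the integer [k]; integer
   indices are needed since p_(j - i) occurs with j < i. *)
Definition point_prob (R : realType) (nu : probability nat R) (k : int) : R :=
  fine (nu [set q : nat | q%:Z = k]).

Definition harmonic_number (R : realType) (n : nat) : R :=
  \sum_(1 <= k < n.+1) k%:R^-1.

(* Main.v *)
Require Import Defs.
From HB Require Import structures.
From mathcomp Require Import all_boot all_order all_algebra.
From mathcomp Require Import all_classical all_reals all_analysis.
From mathcomp Require Import ring lra zify.

Set Implicit Arguments.
Unset Strict Implicit.
Unset Printing Implicit Defensive.

Import Order.TTheory GRing.Theory Num.Theory.
Import numFieldNormedType.Exports.

Local Open Scope classical_set_scope.
Local Open Scope ring_scope.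

(** Write rho = lambda / mu and H(z) = sum_(1 <= k <= n) z^k / k. The law of the
    chain is found through its generating function. For z in [0, 1], the
    function u(t, k) = E_k(z^(Q_t)) is a bounded solution of the backward
    equation u' = G u, where G is the generator, and u(0, k) = z^k. Another
    bounded solution with the same initial value is explicit:
      v(t, k) = w^k exp(rho (H(z) - H(w))),   w = 1 - (1 - z) exp(- mu t);
    the power w^k is the contribution of the k initial customers, each of whom
    is still present at time t with probability exp(- mu t), and the exponential
    is that of the batches that have arrived since.
    Bounded solutions are unique by a maximum principle
    ([backward_maximum_principle]), so u = v ([transition_pgfE]), and letting t
    tend to infinity, hence w to 1, gives
      E_k(z^(Q_t)) --> exp(rho (H(z) - H(1))).

    The backward equation is the one that a transition function inherits directly
    from its derivatives at 0: the rows of G have finitely many nonzero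
    entries and sum to 0, so Chapman-Kolmogorov transports the derivatives
    to every time ([mean_backward_equation]). The maximum principle also takes
    care of explosion: the function k |-> 1 + k grows at most linearly
    under G, and this excludes an escape to infinity.

    On the other side, let r be defined by the recursion of the theorem and let
    S_N(z) be the partial sums of its generating function. The recursion reads
      S_N'(z) = rho sum_(1 <= i <= n) z^(i - 1) S_(N - i)(z),
    which is the equation F' = rho H' F of F = exp(rho (H - H(1))) up to a
    tail of the sum of r, so S_N exp(- rho H) is almost constant
    ([weight_poly_exp_bounds]). Hence S_N tends to F on all of [0, 1]; the point
    z = 1 says that r is a probability distribution.

    Convergence of generating functions gives convergence of each p_t(k, j) to
    r_j ([pgf_continuity]), and averaging over the initial law concludes
    ([cvg_markov_distribution]). *)

(** * The recursion and its generating polynomials *)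

(** One application of the recursion to a candidate sequence f, with terms of
    negative index left out. Iterating it from any sequence stabilises the value
    at j after j + 1 rounds, which turns the course-of-values recursion into a
    plain iteration. *)
Definition recursion_step (R : realType) (rho : R) (n : nat) (f : nat -> R)
    (j : nat) : R :=
  if j is 0 then expR (- rho * harmonic_number R n)
  else rho / j%:R * \sum_(1 <= i < n.+1 | (i <= j)%N) f (j - i)%N.

Definition recursion_weight (R : realType) (rho : R) (n j : nat) : R :=
  iter j.+1 (recursion_step rho n) (fun=> 0) j.

Lemma eq_recursion_step (R : realType) (rho : R) (n : nat) (f g : nat -> R)
    (j : nat) :
  (forall l, (l < j)%N -> f l = g l) ->
  recursion_step rho n f j = recursion_step rho n g j.
Proof.
case: j => // j fg; rewrite /recursion_step; apply: congr1.
rewrite big_nat_cond [RHS]big_nat_cond; apply: eq_bigr => i.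
by move=> /andP[/andP[i_ge1 _] ij]; apply: fg; rewrite ltn_subrL i_ge1.
Qed.

Lemma iter_recursion_step (R : realType) (rho : R) (n m1 m2 j : nat) :
  (j < m1)%N -> (j < m2)%N ->
  iter m1 (recursion_step rho n) (fun=> 0) j =
  iter m2 (recursion_step rho n) (fun=> 0) j.
Proof.
elim: m1 m2 j => // m1 IH [//|m2] j jm1 jm2.
rewrite !iterS; apply: eq_recursion_step => l lj.
by apply: IH; apply: leq_trans lj _; rewrite -ltnS.
Qed.

Section recursion.
Context (R : realType) (rho : R) (n : nat).
Local Notation r := (recursion_weight rho n).

Lemma recursion_weight0 : r 0 = expR (- rho * harmonic_number R n).
Proof. by []. Qed.

Lemma recursion_weightS (j : nat) : (0 < j)%N ->
  r j = rho / j%:R * \sum_(1 <= i < n.+1 | (i <= j)%N) r (j - i)%N.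
Proof.
move=> j0; rewrite /recursion_weight iterS.
rewrite (@eq_recursion_step _ _ _ _ r) => [|l lj]; first by case: j j0.
exact: iter_recursion_step.
Qed.

Lemma recursion_weight_ge0 (j : nat) : 0 <= rho -> 0 <= r j.
Proof.
move=> rho0; elim/ltn_ind: j => -[_|j IH]; first exact: expR_ge0.
rewrite recursion_weightS// mulr_ge0 ?divr_ge0//.
rewrite big_nat_cond sumr_ge0// => i /andP[/andP[i_ge1 _] ij].
by apply: IH; rewrite ltn_subrL i_ge1.
Qed.

Definition harmonic_poly : {poly R} := \sum_(1 <= k < n.+1) k%:R^-1 *: 'X^k.

Definition weight_poly (N : nat) : {poly R} := \sum_(0 <= j < N) r j *: 'X^j.

Lemma deriv_harmonic_poly :
  harmonic_poly^`() = \sum_(1 <= k < n.+1) 'X^(k.-1).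
Proof.
rewrite /harmonic_poly raddf_sum /= big_nat_cond [RHS]big_nat_cond.
apply: eq_bigr => k /andP[/andP[k1 _] _].
by rewrite derivZ derivXn -[X in _ *: X]scaler_nat scalerA mulVf ?scale1r//
   pnatr_eq0 -lt0n.
Qed.

(** The recursion in generating-function form: j r_j z^(j - 1) is
    rho z^(i - 1) r_(j - i) z^(j - i) summed over i, and exchanging the two sums
    leaves shorter partial sums of the same series. *)
Lemma deriv_weight_poly (N : nat) :
  (weight_poly N)^`() =
  rho *: \sum_(1 <= i < n.+1) 'X^(i.-1) * weight_poly (N - i).
Proof.
pose F i j : {poly R} := (rho * r (j - i)%N) *: 'X^(j.-1).
transitivity (\sum_(0 <= j < N) \sum_(1 <= i < n.+1 | (i <= j)%N) F i j).
  rewrite /weight_poly raddf_sum /=; apply: eq_bigr => -[|j] _.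
    rewrite derivZ derivXn mulr0n scaler0 big_nat_cond big1//.
    by move=> -[|i]; rewrite ?andbF.
  rewrite derivZ derivXn -[X in _ *: X]scaler_nat scalerA recursion_weightS//.
  rewrite mulrAC divfK ?pnatr_eq0// mulr_sumr scaler_suml.
  by apply: eq_bigr.
rewrite (exchange_big_dep_nat predT)//= scaler_sumr.
rewrite big_nat_cond [RHS]big_nat_cond.
apply: eq_bigr => i /andP[/andP[i1 _] _].
have -> : \sum_(0 <= j < N | (i <= j)%N) F i j = \sum_(i <= j < N) F i j.
  by rewrite [RHS](big_nat_widenl _ 0%N).
rewrite -{1}(add0n i) big_addn.
rewrite /weight_poly mulr_sumr scaler_sumr; apply: eq_bigr => j _.
rewrite /F addnK -scalerA -scalerAr -exprD; congr (_ *: (_ *: 'X^_)).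
by rewrite addnC; case: i i1.
Qed.
End recursion.

(** * The generating function of the recursion *)

Section recursion_pgf.
Context (R : realType) (rho : R) (n : nat).
Hypothesis rho_ge0 : 0 <= rho.
Local Notation r := (recursion_weight rho n).
Local Notation H := (harmonic_poly R n).
Local Notation S := (weight_poly rho n).

Lemma harmonic_poly1 : H.[1] = harmonic_number R n.
Proof.
rewrite horner_sum; apply: eq_bigr => k _.
by rewrite hornerZ hornerXn expr1n mulr1.
Qed.

Lemma harmonic_poly0 : H.[0] = 0.
Proof.
rewrite horner_sum big_nat_cond big1// => k /andP[/andP[k1 _] _].
by rewrite hornerZ hornerXn expr0n -[k == _]negbK -lt0n k1 mulr0.
Qed.

Lemma harmonic_poly_ge0 (x : R) : 0 <= x -> 0 <= H.[x].
Proof.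
move=> x0; rewrite horner_sum sumr_ge0// => k _.
by rewrite hornerZ hornerXn mulr_ge0// ?invr_ge0// exprn_ge0.
Qed.

Lemma horner_weight_poly (N : nat) (x : R) :
  (S N).[x] = \sum_(0 <= j < N) r j * x ^+ j.
Proof.
by rewrite horner_sum; apply: eq_bigr => j _; rewrite hornerZ hornerXn.
Qed.

Lemma weight_poly_sub (M N : nat) (x : R) : (M <= N)%N ->
  (S N).[x] - (S M).[x] = \sum_(M <= j < N) r j * x ^+ j.
Proof.
move=> MN; rewrite !horner_weight_poly (big_cat_nat (leq0n M) MN)/=.
by rewrite addrAC subrr add0r.
Qed.

Lemma weight_poly_sub_ge0 (M N : nat) (x : R) : (M <= N)%N -> 0 <= x ->
  0 <= (S N).[x] - (S M).[x].
Proof.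
move=> MN x0; rewrite weight_poly_sub// sumr_ge0// => j _.
by rewrite mulr_ge0 ?exprn_ge0// recursion_weight_ge0.
Qed.

Lemma weight_poly_sub_le (M N : nat) (x : R) : (M <= N)%N -> 0 <= x <= 1 ->
  (S N).[x] - (S M).[x] <= x ^+ M * ((S N).[1] - (S M).[1]).
Proof.
move=> MN /andP[x0 x1]; rewrite !weight_poly_sub// mulr_sumr !big_nat.
apply: ler_sum => j /andP[Mj _].
rewrite expr1n mulr1 mulrC ler_wpM2r ?recursion_weight_ge0//.
by rewrite ler_wiXn2l.
Qed.

Lemma weight_poly0 (N : nat) : (S N.+1).[0] = r 0.
Proof.
rewrite horner_weight_poly big_nat_recl// big1 ?addr0 ?expr0 ?mulr1// => j _.
by rewrite expr0n mulr0.
Qed.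

(** The mean value theorem for S_N exp(- rho H): its derivative is
    (S_N' - rho H' S_N) exp(- rho H), and by [deriv_weight_poly] the first factor
    only involves the differences S_N - S_(N - i). *)
Lemma weight_poly_exp_mvt (N : nat) (z : R) : 0 <= z ->
  exists2 c, 0 <= c <= z &
    r 0 - (S N.+1).[z] * expR (- rho * H.[z]) =
    rho * expR (- rho * H.[c]) * z *
    \sum_(1 <= i < n.+1) c ^+ i.-1 * ((S N.+1).[c] - (S (N.+1 - i)).[c]).
Proof.
move=> z0; pose f (x : R) := (S N.+1).[x] * expR (- rho * H.[x]).
pose df (x : R) := (S N.+1).[x] * (expR (- rho * H.[x]) * (- rho * H^`().[x])) +
  expR (- rho * H.[x]) * (S N.+1)^`().[x].
have fD (x : R) : is_derive x (1 : R) f (df x).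
  rewrite /f /df.
  have H1 : is_derive x (1 : R) (fun x : R => - rho * H.[x]) (- rho * H^`().[x]).
    exact: is_deriveZ.
  have H2 : is_derive x (1 : R) (fun x : R => expR (- rho * H.[x]))
     (expR (- rho * H.[x]) * (- rho * H^`().[x])).
    exact: (is_derive1_comp (f := expR)).
  by apply: is_deriveM.
have fc : {within `[0, z], continuous f}.
  apply: continuous_subspaceT => x.
  apply/differentiable_continuous/derivable1_diffP.
  by have [] := fD x.
have [c] := MVT_segment z0 (fun x _ => fD x) fc.
rewrite in_itv/= => cz fz; exists c => //.
have -> : r 0 = f 0 by rewrite /f weight_poly0 harmonic_poly0 mulr0 expR0 mulr1.
have HD : H^`().[c] = \sum_(1 <= i < n.+1) c ^+ i.-1.
  rewrite deriv_harmonic_poly horner_sum.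
  by apply: eq_bigr => i _; rewrite hornerXn.
have SD : (S N.+1)^`().[c] =
    rho * \sum_(1 <= i < n.+1) c ^+ i.-1 * (S (N.+1 - i)).[c].
  rewrite deriv_weight_poly hornerZ horner_sum; congr (_ * _).
  by apply: eq_bigr => i _; rewrite hornerM hornerXn.
under eq_bigr do rewrite mulrBr.
rewrite sumrB -mulr_suml -HD -/(f z) -opprB fz subr0 /df SD; ring.
Qed.

(** The upper bound no longer depends on z and involves only the last n terms of
    the series at 1. The left inequality bounds S_N(1) by 1, hence shows
    that the series converges; the right-hand bound then tends to 0 as N grows. *)
Lemma weight_poly_exp_bounds (N : nat) (z : R) : 0 <= z <= 1 ->
  0 <= r 0 - (S N.+1).[z] * expR (- rho * H.[z]) <=
    rho * n%:R * ((S N.+1).[1] - (S (N.+1 - n)).[1]).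
Proof.
move=> /andP[z0 z1]; have [c /andP[c0 cz] ->] := weight_poly_exp_mvt N z0.
have c1 : c <= 1 by apply: le_trans z1.
have sum_ge0 : 0 <= \sum_(1 <= i < n.+1)
    c ^+ i.-1 * ((S N.+1).[c] - (S (N.+1 - i)).[c]).
  rewrite sumr_ge0// => i _.
  by rewrite mulr_ge0 ?exprn_ge0// weight_poly_sub_ge0// leq_subr.
have fac_ge0 : 0 <= rho * expR (- rho * H.[c]) * z.
  by rewrite !mulr_ge0// expR_ge0.
rewrite mulr_ge0//= -[leRHS]mulrA; apply: ler_pM => //.
  rewrite -[leRHS]mulr1 -mulrA ler_wpM2l// mulr_ile1// ?expR_ge0//.
  by rewrite -expR0 ler_expR mulNr oppr_le0 mulr_ge0// harmonic_poly_ge0.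
have -> : n%:R * ((S N.+1).[1] - (S (N.+1 - n)).[1]) =
    \sum_(1 <= i < n.+1) ((S N.+1).[1] - (S (N.+1 - n)).[1]).
  by rewrite sumr_const_nat subn1 mulr_natl.
rewrite !big_nat; apply: ler_sum => i /andP[i1 iN].
rewrite -[leRHS]mul1r; apply: ler_pM; rewrite ?exprn_ge0// ?exprn_ile1//.
  by rewrite weight_poly_sub_ge0// leq_subr.
apply: (@le_trans _ _ ((S N.+1).[1] - (S (N.+1 - i)).[1])).
  apply: le_trans (weight_poly_sub_le _ _) _; rewrite ?leq_subr ?c0//.
  rewrite ler_piMl ?exprn_ile1//.
  by rewrite weight_poly_sub_ge0// leq_subr.
rewrite lerD2l lerN2 -subr_ge0 weight_poly_sub_ge0//.
by rewrite leq_sub2l.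
Qed.

Lemma weight_poly_le (N : nat) (z : R) : 0 <= z <= 1 ->
  (S N).[z] <= expR (rho * (H.[z] - H.[1])).
Proof.
move=> z01; case: N => [|N].
  by rewrite horner_weight_poly big_geq ?expR_ge0.
have /andP[+ _] := weight_poly_exp_bounds N z01.
rewrite subr_ge0 mulNr expRN -ler_pdivlMr ?invr_gt0 ?expR_gt0// invrK.
by rewrite recursion_weight0 -harmonic_poly1 -expRD mulNr mulrBr addrC.
Qed.

Lemma weight_poly1_le1 (N : nat) : (S N).[1] <= 1.
Proof.
apply: le_trans (weight_poly_le _ _) _; first by rewrite ler01 lexx.
by rewrite subrr mulr0 expR0.
Qed.

Lemma cvg_weight_poly (z : R) : 0 <= z <= 1 ->
  (S N).[z] @[N --> \oo] --> expR (rho * (H.[z] - H.[1])).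
Proof.
move=> z01.
have S1 : cvgn (fun N => (S N).[1]).
  apply: nondecreasing_is_cvgn.
    by move=> M N MN; rewrite -subr_ge0 weight_poly_sub_ge0.
  by exists 1 => _ [N _ <-]; exact: weight_poly1_le1.
have gap : (S N.+1).[1] - (S (N.+1 - n)).[1] @[N --> \oo] --> (0 : R).
  rewrite -(subrr (limn (fun N => (S N).[1]))).
  apply: cvgB; first by rewrite (cvg_shiftS (fun N => (S N).[1])).
  rewrite (cvg_shiftS (fun N => (S (N - n)).[1])).
  rewrite -(cvg_shiftn n); under eq_fun do rewrite addnK.
  exact: S1.
rewrite -cvg_shiftS.
have SE N : (S N.+1).[z] = (r 0 - (r 0 - (S N.+1).[z] * expR (- rho * H.[z]))) *
     expR (rho * H.[z]).
  by rewrite subKr mulNr expRN mulfVK// gt_eqF ?expR_gt0.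
under eq_fun do rewrite SE.
have -> : expR (rho * (H.[z] - H.[1])) = (r 0 - 0) * expR (rho * H.[z]).
  by rewrite subr0 recursion_weight0 -harmonic_poly1 -expRD mulNr mulrBr addrC.
apply: cvgMl; apply: cvgB; first exact: cvg_cst.
apply: (@squeeze_cvgr _ _ _ _ (cst 0)
  (fun N => rho * n%:R * ((S N.+1).[1] - (S (N.+1 - n)).[1]))).
- by apply: nearW => N /=; exact: weight_poly_exp_bounds.
- exact: cvg_cst.
- by rewrite -(mulr0 (rho * n%:R)); apply: cvgMr.
Qed.

(** The remainder of index N is at most z^N times the total mass of the tail. *)
Lemma le_weight_poly (N : nat) (z : R) : 0 <= z <= 1 ->
  expR (rho * (H.[z] - H.[1])) <= (S N).[z] + z ^+ N.
Proof.
move=> z01; have [z0 z1] := andP z01.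
rewrite -(cvg_lim _ (cvg_weight_poly z01))//.
apply: limr_le; first by apply: cvgP; exact: cvg_weight_poly z01.
exists N => // M /= NM; rewrite -lerBlDl.
apply: le_trans (weight_poly_sub_le NM z01) _.
rewrite ler_piMr ?exprn_ge0// lerBlDr; apply: le_trans (weight_poly1_le1 _) _.
rewrite lerDl horner_weight_poly sumr_ge0// => j _.
by rewrite expr1n mulr1 recursion_weight_ge0.
Qed.

End recursion_pgf.

(** * A maximum principle for the backward equation *)

(** The generator applied to f. At k = 0 the junk value of [k.-1] is harmless,
    since its coefficient vanishes. *)
Definition batch_queue_drift (R : realType) (lambda mu : R) (n : nat)
    (f : nat -> R) (k : nat) : R :=
  lambda * f (k + n)%N + mu * k%:R * f k.-1 - (lambda + mu * k%:R) * f k.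

Lemma near_at_right0P (R : realType) (A : R -> Prop) :
  (\forall h \near 0^'+, A h) <->
  exists2 e : R, 0 < e & forall h, 0 < h < e -> A h.
Proof.
split=> [[e /= e0 eA]|[e e0 eA]].
  exists e => // h /andP[h0 he]; apply: eA => //=.
  by rewrite sub0r normrN gtr0_norm.
near=> h; apply: eA; apply/andP; split; near: h.
  exact: nbhs_right_gt.
exact: nbhs_right_lt.
Unshelve. all: by end_near. Qed.

Lemma near_ltn_forall (R : realType) (A : nat -> R -> Prop) (K : nat) :
  (forall k, \forall h \near 0^'+, A k h) ->
  \forall h \near (0 : R)^'+, forall k, (k < K)%N -> A k h.
Proof.
move=> nA; elim: K => [|K IH]; first by apply: nearW.
near=> h => k; rewrite ltnS leq_eqVlt => /predU1P[->|kK].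
  by near: h; exact: nA.
by move: k kK; near: h; exact: IH.
Unshelve. all: by end_near. Qed.

(** A bounded subsolution of the backward equation that starts below 0 stays
    below 0. It is compared with the barrier e (1 + k + c t): because G maps
    1 + k to at most lambda n, the barrier is a strict supersolution as soon as
    c > lambda n, and because it tends to infinity with k, only finitely many
    states can violate the comparison. Letting e tend to 0 concludes. The
    argument runs on right derivatives and left continuity, which is the
    regularity that the semigroup property provides directly. *)
Section maximum_principle.
Context (R : realType) (lambda mu : R) (n : nat) (D : R -> nat -> R) (C : R).
Hypotheses (lambda_ge0 : 0 <= lambda) (mu_ge0 : 0 <= mu).
Hypothesis D_le : forall (t : R) k, 0 <= t -> D t k <= C.
Hypothesis D0_le0 : forall k, D 0 k <= 0.
Hypothesis D_left : forall (t : R) k, 0 < t -> D s k @[s --> t^'-] --> D t k.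
Hypothesis D_right : forall (t : R) k, 0 <= t ->
  (D (t + h) k - D t k) / h @[h --> 0^'+] -->
  batch_queue_drift lambda mu n (D t) k.

Let c := lambda * n%:R + 1.
Let W (e t : R) (k : nat) := e * (1 + k%:R + c * t).

Let c_ge0 : 0 <= c. Proof. by rewrite addr_ge0// mulr_ge0. Qed.

Lemma drift_barrier (e t : R) (k : nat) : 0 < e ->
  batch_queue_drift lambda mu n (W e t) k < e * c.
Proof.
move=> e0; rewrite /batch_queue_drift /W.
have -> : mu * k%:R * (e * (1 + k.-1%:R + c * t)) =
          mu * k%:R * (e * (k%:R + c * t)).
  by case: k => [|k]; rewrite ?mulr0 ?mul0r//= -[k.+1%:R]nat1r.
rewrite natrD -subr_gt0 [ltRHS](_ : _ = e * (1 + mu * k%:R)).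
  by rewrite mulr_gt0// ltr_wpDr// mulr_ge0.
by rewrite /c; ring.
Qed.

(** Where D touches the barrier from below, the off-diagonal coefficients of G,
    which are nonnegative, can only make G D smaller than G W. *)
Lemma drift_at_contact (e t : R) (k : nat) :
  0 < e -> (forall l, D t l <= W e t l) -> D t k = W e t k ->
  batch_queue_drift lambda mu n (D t) k < e * c.
Proof.
move=> e0 DW Dk; apply: le_lt_trans (drift_barrier t k e0).
rewrite /batch_queue_drift Dk lerD2r lerD//; apply: ler_wpM2l => //.
by rewrite mulr_ge0.
Qed.

(** At a state where D touches the barrier, D grows more slowly than the barrier;
    at any other state there is room left, and D cannot jump to the right because
    it has a right derivative. *)
Lemma barrier_propagates (e t : R) (k : nat) :
  0 < e -> 0 <= t -> (forall l, D t l <= W e t l) ->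
  \forall h \near 0^'+, D (t + h) k <= W e (t + h) k.
Proof.
move=> e0 t0 DW.
(* B is a slope that D does not exceed just after t, and a line of slope B that
   starts at D t k stays below the barrier for a time M. *)
have [B DB [M M0 MB]] : exists2 B, batch_queue_drift lambda mu n (D t) k < B &
    exists2 M : R, 0 < M & forall h : R, 0 < h < M ->
      h * B <= W e t k - D t k + e * c * h.
  have := DW k; rewrite le_eqVlt => /predU1P[Dk|Dk].
    exists (e * c); first exact: drift_at_contact.
    by exists 1 => // h _; rewrite Dk subrr add0r mulrC.
  exists (`|batch_queue_drift lambda mu n (D t) k| + 1).
    by rewrite (le_lt_trans (ler_norm _))// ltrDl.
  set B := _ + 1; have B0 : 0 < B by rewrite ltr_wpDl.
  exists ((W e t k - D t k) / B); first by rewrite divr_gt0// subr_gt0.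
  move=> h /andP[h0]; rewrite ltr_pdivlMr// => /ltW hB.
  by rewrite (le_trans hB)// lerDl !mulr_ge0// ltW.
have q := cvgr_lt _ (D_right (k := k) t0) _ DB.
near=> h; have h0 : 0 < h by near: h; exact: nbhs_right_gt.
have qh : (D (t + h) k - D t k) / h < B by near: h; exact: q.
have : h * B <= W e t k - D t k + e * c * h.
  by apply: MB; rewrite h0/=; near: h; exact: nbhs_right_lt.
move: qh; rewrite ltr_pdivrMr// => qh.
rewrite /W; nra.
Unshelve. all: by end_near. Qed.

(** Let T be the infimum of the times at which the comparison fails. It holds
    before T, hence at T by left continuity, hence on a right neighbourhood of T
    that is uniform in the finitely many states below K: a contradiction. *)
Lemma le_barrier (e t : R) (k : nat) : 0 < e -> 0 <= t -> D t k <= W e t k.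
Proof.
move=> e0 t0; rewrite leNgt; apply/negP => Dt.
pose A := [set s : R | 0 <= s /\ exists l, W e s l < D s l].
have At : A t by split => //; exists k.
have lbA : lbound A 0 by move=> s [].
have infA : has_inf A by split; [exists t|exists 0].
set T := inf A.
have T0 : 0 <= T by apply: lb_le_inf => //; exists t.
have before s l : 0 <= s -> s < T -> D s l <= W e s l.
  move=> s0 sT; rewrite leNgt; apply/negP => Ds.
  have : T <= s by apply: ge_inf; [exists 0|split => //; exists l].
  by rewrite leNgt sT.
have atT l : D T l <= W e T l.
  move: T0; rewrite le_eqVlt => /predU1P[<-|T0].
    by rewrite (le_trans (D0_le0 l))// /W mulr0 addr0 mulr_ge0 ?addr_ge0// ltW.
  apply: (cvgr_to_le (D_left (k := l) T0)).
  near=> s; have s0 : 0 < s by near: s; exact: nbhs_left_gt.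
  have sT : s < T by near: s; exact: nbhs_left_lt.
  apply: le_trans (before _ _ (ltW s0) sT) _.
  by rewrite /W ler_pM2l// lerD2l ler_wpM2l// ltW.
(* Beyond K the barrier exceeds the global bound C. *)
pose K := Num.bound `|C / e|.
have large s l : 0 <= s -> (K <= l)%N -> D s l <= W e s l.
  move=> s0 Kl; rewrite (le_trans (D_le _ s0))// /W.
  have CK : C / e < K%:R.
    exact: le_lt_trans (ler_norm _) (archi_boundP (normr_ge0 _)).
  rewrite mulrC -ler_pdivrMr// (le_trans (ltW CK))//.
  have : K%:R <= l%:R :> R by rewrite ler_nat.
  by have := mulr_ge0 c_ge0 s0; lra.
have [d d0 dA] : exists2 d : R, 0 < d &
    forall h, 0 < h < d -> forall l, (l < K)%N -> D (T + h) l <= W e (T + h) l.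
  apply/near_at_right0P/near_ltn_forall => l.
  exact: barrier_propagates.
have : T + d <= T.
  apply: lb_le_inf; first by exists t.
  move=> s [s0 [l Wl]].
  have Ts : T <= s by apply: ge_inf; [exists 0|split => //; exists l].
  rewrite leNgt; apply/negP => sTd; move: Wl; rewrite ltNge => /negP; apply.
  have [lK|Kl] := ltnP l K; last exact: large.
  move: Ts; rewrite le_eqVlt => /predU1P[<- //|Ts].
  rewrite -(subrKC T s); apply: dA => //.
  by rewrite subr_gt0 Ts ltrBlDl.
by rewrite gerDl leNgt d0.
Unshelve. all: by end_near. Qed.

Lemma backward_maximum_principle (t : R) (k : nat) : 0 <= t -> D t k <= 0.
Proof.
move=> t0; rewrite leNgt; apply/negP => D0.
set b := 1 + k%:R + c * t.
have b0 : 0 < b by rewrite /b ltr_wpDr ?mulr_ge0// ltr_wpDr.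
have e0 : 0 < D t k / 2 / b by rewrite !divr_gt0.
have := le_barrier k e0 t0.
by rewrite /W -/b divfK ?gt_eqF//; lra.
Qed.

End maximum_principle.

(** * The explicit solution of the backward equation *)

Section explicit_solution.
Context (R : realType) (lambda mu : R) (n : nat).
Hypotheses (lambda_ge0 : 0 <= lambda) (mu_gt0 : 0 < mu).
Let rho := lambda / mu.
Local Notation H := (harmonic_poly R n).

Let rho_ge0 : 0 <= rho. Proof. by rewrite divr_ge0// ltW. Qed.

(** The generating function at z of the indicator that a customer present at
    time 0 is still present at time t. *)
Definition thinned (z t : R) : R := 1 - (1 - z) * expR (- (mu * t)).

Definition queue_pgf (z t : R) (k : nat) : R :=
  thinned z t ^+ k * expR (rho * (H.[z] - H.[thinned z t])).

Lemma thinned_itv (z t : R) : 0 <= z <= 1 -> 0 <= t -> 0 <= thinned z t <= 1.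
Proof.
move=> /andP[z0 z1] t0; rewrite subr_ge0 gerBl.
rewrite (mulr_ge0 _ (expR_ge0 _)) ?subr_ge0// andbT mulr_ile1 ?subr_ge0//.
- by rewrite gerBl.
- by rewrite -expR0 ler_expR oppr_le0 mulr_ge0// ltW.
Qed.

Lemma queue_pgf0 (z : R) (k : nat) : queue_pgf z 0 k = z ^+ k.
Proof.
have thinned0 : thinned z 0 = z by rewrite /thinned mulr0 oppr0 expR0; ring.
by rewrite /queue_pgf thinned0 subrr mulr0 expR0 mulr1.
Qed.

Lemma queue_pgf_itv (z t : R) (k : nat) : 0 <= z <= 1 -> 0 <= t ->
  0 <= queue_pgf z t k <= expR (rho * H.[z]).
Proof.
move=> z01 t0; have /andP[w0 w1] := thinned_itv z01 t0.
rewrite /queue_pgf mulr_ge0 ?exprn_ge0 ?expR_ge0//=.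
rewrite -[leRHS]mul1r ler_pM ?exprn_ge0 ?expR_ge0 ?exprn_ile1//.
by rewrite ler_expR ler_wpM2l// gerBl harmonic_poly_ge0.
Qed.

(** H' is a geometric sum; this identity is what turns the derivative of the
    exponential factor into the arrival term w^n - 1 of the generator. *)
Lemma deriv_harmonic_poly_geometric (x : R) :
  (1 - x) * H^`().[x] = 1 - x ^+ n.
Proof.
rewrite -[1 - x ^+ n]opprB subrX1 -mulNr opprB; congr (_ * _).
rewrite deriv_harmonic_poly horner_sum big_add1 big_mkord.
by apply: eq_bigr => i _; rewrite hornerXn.
Qed.

Lemma is_derive_power_exp (a x : R) (k : nat) :
  is_derive x (1 : R) (fun y : R => y ^+ k * expR (rho * (a - H.[y])))
    ((k%:R * x ^+ k.-1 - rho * H^`().[x] * x ^+ k) * expR (rho * (a - H.[x]))).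
Proof.
have D1 : is_derive x (1 : R) (fun y : R => rho * (a - H.[y]))
    (rho * (0 - H^`().[x])).
  apply: (is_deriveZ (f := fun y => a - H.[y])).
have D2 : is_derive x (1 : R) (fun y : R => expR (rho * (a - H.[y])))
    (expR (rho * (a - H.[x])) * (rho * (0 - H^`().[x]))).
  exact: (is_derive1_comp (f := expR)).
have D3 : is_derive x (1 : R) (fun y : R => y ^+ k) (k%:R * x ^+ k.-1).
  have := is_deriveX k (is_derive_id x (1 : R)).
  by rewrite exprfctE => /is_derive_eq; apply; rewrite /GRing.scale /= mulr1.
apply: is_derive_eq; rewrite /GRing.scale /=; ring.
Qed.

Lemma is_derive_thinned (z t : R) :
  is_derive t (1 : R) (thinned z) (mu * (1 - thinned z t)).
Proof.
have D1 : is_derive t (1 : R) (fun s : R => - (mu * s)) (- (mu * 1)).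
  by apply: is_deriveN.
have D2 : is_derive t (1 : R) (fun s : R => expR (- (mu * s)))
    (expR (- (mu * t)) * - (mu * 1)).
  exact: (is_derive1_comp (f := expR)).
rewrite /thinned; apply: is_derive_eq; rewrite /GRing.scale /=; ring.
Qed.

(** Since w' = mu (1 - w), differentiating w^k gives the departure terms
    mu k (w^(k - 1) - w^k), and differentiating the exponential gives
    - rho H'(w) mu (1 - w) = lambda (w^n - 1). *)
Lemma is_derive_queue_pgf (z t : R) (k : nat) :
  is_derive t (1 : R) (queue_pgf z ^~ k)
    (batch_queue_drift lambda mu n (queue_pgf z t) k).
Proof.
have := is_derive1_comp (is_derive_power_exp H.[z] (thinned z t) k)
  (is_derive_thinned z t).
rewrite /queue_pgf => /is_derive_eq; apply.
rewrite /batch_queue_drift; set w := thinned z t; set e := expR _.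
have := deriv_harmonic_poly_geometric w; set h := H^`().[w] => hE.
have wk : k%:R * w ^+ k = k%:R * w ^+ k.-1 * w.
  by case: k => [|k]; rewrite ?mul0r//= exprSr mulrA.
transitivity (e * (mu * (k%:R * w ^+ k.-1 - k%:R * w ^+ k.-1 * w)
   - rho * mu * ((1 - w) * h) * w ^+ k)); first by ring.
rewrite -wk hE /rho divfK ?gt_eqF// exprD; ring.
Qed.

Lemma cvg_thinned (z : R) : thinned z t @[t --> +oo] --> (1 : R).
Proof.
rewrite -[X in _ --> X]subr0 -[X in _ --> _ - X](mulr0 (1 - z)).
apply: cvgB; first exact: cvg_cst.
apply: cvgMr.
apply: (cvg_comp _ (fun x => expR (- x))) (@cvgr_expR R).
exact: gt0_cvgMry.
Qed.

Lemma cvg_queue_pgf (z : R) (k : nat) :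
  queue_pgf z t k @[t --> +oo] --> expR (rho * (H.[z] - H.[1])).
Proof.
pose phi (y : R) := y ^+ k * expR (rho * (H.[z] - H.[y])).
have -> : expR (rho * (H.[z] - H.[1])) = phi 1.
  by rewrite /phi expr1n mul1r.
apply: (cvg_comp _ phi (cvg_thinned z)).
apply/differentiable_continuous/derivable1_diffP.
by have [] := is_derive_power_exp H.[z] 1 k.
Qed.

End explicit_solution.

(** * The backward equation of a transition function *)

Definition series_mean (R : realType) (a f : nat -> R) : R :=
  fine (\sum_(0 <= j <oo) (a j * f j)%:E)%E.

Section series_mean.
Context (R : realType) (a f : nat -> R).
Hypothesis a_ge0 : forall j, 0 <= a j.
Hypothesis a_sum : (\sum_(0 <= j <oo) (a j)%:E = 1)%E.
Hypothesis f_itv : forall j, 0 <= f j <= 1.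

Lemma partial_sum_le1 (N : nat) : \sum_(0 <= j < N) a j <= 1.
Proof.
rewrite -lee_fin -sumEFin -a_sum; apply: nneseries_lim_ge => j _ _.
by rewrite lee_fin.
Qed.

Lemma series_meanE :
  (\sum_(0 <= j <oo) (a j * f j)%:E = (series_mean a f)%:E)%E.
Proof.
rewrite /series_mean fineK// ge0_fin_numE.
  apply: (@le_lt_trans _ _ 1%E); last exact: ltry.
  rewrite -a_sum; apply: lee_nneseries => j _.
    by rewrite lee_fin mulr_ge0//; have /andP[] := f_itv j.
  by rewrite lee_fin ler_piMr//; have /andP[] := f_itv j.
apply: nneseries_ge0 => j _ _.
by rewrite lee_fin mulr_ge0//; have /andP[] := f_itv j.
Qed.

Lemma partial_sum_le_series_mean (N : nat) :
  \sum_(0 <= j < N) a j * f j <= series_mean a f.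
Proof.
rewrite -lee_fin -sumEFin -series_meanE; apply: nneseries_lim_ge => j _ _.
by rewrite lee_fin mulr_ge0//; have /andP[] := f_itv j.
Qed.

Lemma series_mean_le_tail (N : nat) (c : R) : 0 <= c ->
  (forall j, (N <= j)%N -> f j <= c) ->
  series_mean a f <=
    \sum_(0 <= j < N) a j * f j + c * (1 - \sum_(0 <= j < N) a j).
Proof.
move=> c0 fc; rewrite -lee_fin -series_meanE; apply: lime_le.
  apply: is_cvg_nneseries => j _ _.
  by rewrite lee_fin mulr_ge0//; have /andP[] := f_itv j.
exists N => // M /= NM; rewrite sumEFin lee_fin (big_cat_nat (leq0n N) NM)/=.
rewrite lerD2l; apply: (@le_trans _ _ (c * \sum_(N <= j < M) a j)).
  rewrite mulr_sumr !big_nat; apply: ler_sum => j /andP[Nj _].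
  by rewrite mulrC ler_wpM2r// fc.
rewrite ler_wpM2l// lerBrDl; apply: le_trans (partial_sum_le1 M).
by rewrite (big_cat_nat (leq0n N) NM).
Qed.

Lemma series_mean_le_tail1 (N : nat) :
  series_mean a f <= \sum_(0 <= j < N) a j * f j + (1 - \sum_(0 <= j < N) a j).
Proof.
rewrite -[X in _ + X]mul1r; apply: series_mean_le_tail => // j _.
by have /andP[] := f_itv j.
Qed.

Lemma series_mean_itv : 0 <= series_mean a f <= 1.
Proof.
have := partial_sum_le_series_mean 0; rewrite big_geq// => -> /=.
by have := series_mean_le_tail1 0; rewrite !big_geq// add0r subr0.
Qed.

(** A distribution that puts mass a_k at k gives f a mean at distance at most
    1 - a_k from f k. Applied to a_k = p_h(k, k), this is the continuity of the
    semigroup at time 0. *)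
Lemma series_mean_near_value (k : nat) :
  `|series_mean a f - f k| <= 1 - a k.
Proof.
have lo := partial_sum_le_series_mean k.+1; have hi := series_mean_le_tail1 k.+1.
have s0 : 0 <= \sum_(0 <= j < k) a j * f j.
  by rewrite sumr_ge0// => j _; rewrite mulr_ge0//; have /andP[] := f_itv j.
have s1 : \sum_(0 <= j < k) a j * f j <= \sum_(0 <= j < k) a j.
  by apply: ler_sum => j _; rewrite ler_piMr//; have /andP[] := f_itv j.
have a1 := partial_sum_le1 k.+1.
move: lo hi a1; rewrite !big_nat_recr//= => lo hi a1.
have /andP[f0 f1] := f_itv k; have ak := a_ge0 k.
by rewrite ler_norml; apply/andP; split; nra.
Qed.

End series_mean.

Section semigroup.
Context (R : realType) (p : R -> nat -> nat -> R).
Hypothesis p_tf : transition_function p.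

Lemma transition_ge0 (t : R) (i j : nat) : 0 <= t -> 0 <= p t i j.
Proof. by case: p_tf => + _ _ _; apply. Qed.

Lemma transition_sum (t : R) (i : nat) : 0 <= t ->
  (\sum_(0 <= j <oo) (p t i j)%:E = 1)%E.
Proof. by case: p_tf => _ + _ _; apply. Qed.

Lemma transition_le1 (t : R) (i j : nat) : 0 <= t -> p t i j <= 1.
Proof.
move=> t0; have pt l := transition_ge0 i l t0.
apply: le_trans (partial_sum_le1 pt (transition_sum i t0) j.+1).
by rewrite big_nat_recr//= lerDr sumr_ge0.
Qed.

Lemma transition0 (i j : nat) : p 0 i j = (i == j)%:R.
Proof. by case: p_tf. Qed.

Lemma chapman_kolmogorov_mean (f : nat -> R) (s t : R) (i : nat) :
  (forall j, 0 <= f j <= 1) -> 0 <= s -> 0 <= t ->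
  series_mean (p (s + t) i) f =
  series_mean (p s i) (fun k => series_mean (p t k) f).
Proof.
move=> f01 s0 t0.
have f0 j : 0 <= f j by have /andP[] := f01 j.
have ps := transition_ge0 i _ s0; have pt := fun k => transition_ge0 k _ t0.
have pst j : 0 <= p (s + t) i j by apply: transition_ge0; exact: addr_ge0.
have sst := transition_sum i (addr_ge0 s0 t0).
have ss := transition_sum i s0; have st := fun k => transition_sum k t0.
have ut k : 0 <= series_mean (p t k) f <= 1 by exact: series_mean_itv.
apply: EFin_inj; rewrite -!series_meanE//.
transitivity (\sum_(0 <= j <oo) \sum_(0 <= k <oo)
   (p s i k * (p t k j * f j))%:E)%E.
  apply: eq_eseriesr => j _; have [_ _ _ ck] := p_tf.
  rewrite EFinM -ck// muleC -nneseriesZl//; last first.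
    by move=> k _; rewrite lee_fin mulr_ge0.
  by apply: eq_eseriesr => k _; rewrite -EFinM; congr EFin; ring.
rewrite nneseries_interchange; last by move=> j k; rewrite lee_fin !mulr_ge0.
apply: eq_eseriesr => k _.
rewrite EFinM -series_meanE//.
rewrite -nneseriesZl// => j _.
by rewrite lee_fin mulr_ge0.
Qed.

End semigroup.

Section backward_equation.
Context (R : realType) (lambda mu : R) (n : nat) (p : R -> nat -> nat -> R).
Hypothesis n_gt0 : (0 < n)%N.
Hypothesis p_tf : transition_function p.
Hypothesis p_gen : has_generator p (batch_queue_generator lambda mu n).

Lemma sum_batch_queue_generator (f : nat -> R) (k : nat) :
  \sum_(0 <= m < (k + n).+1) batch_queue_generator lambda mu n k m * f m =
  batch_queue_drift lambda mu n f k.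
Proof.
pose F m := (if m == (k + n)%N then lambda * f m else 0) +
  (if m.+1 == k then mu * k%:R * f m else 0) -
  (if m == k then (lambda + mu * k%:R) * f m else 0).
rewrite (eq_bigr F) => [|m _]; last first.
  rewrite /F /batch_queue_generator.
  case: (eqVneq m (k + n)%N) => [->|_].
    rewrite (_ : (_.+1 == k) = false); last by apply/eqP; lia.
    rewrite (_ : (_ == k) = false); last by apply/eqP; lia.
    by rewrite /= addr0 subr0.
  case: (eqVneq m.+1 k) => [mk|_].
    rewrite (_ : (_ == k) = false); last by apply/eqP; lia.
    by rewrite /= add0r subr0.
  by case: eqVneq => _; rewrite /= !add0r ?mulNr ?mul0r ?oppr0.
rewrite /F !big_split/= -!big_mkcond/= sumrN -big_mkcond/= !big_nat1_eq.
rewrite /batch_queue_drift ltnSn ltnS leq_addr/=; congr (_ + _ - _).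
case: k {F} => [|k]; first by rewrite mulr0 mul0r big1.
by rewrite big_nat1_eq/= ifT//; lia.
Qed.

Lemma cvg_transition_diag (k : nat) : p h k k @[h --> 0^'+] --> (1 : R).
Proof.
have q : (p h k k - 1) / h @[h --> 0^'+] -->
    batch_queue_generator lambda mu n k k.
  by have := @p_gen k k; rewrite eqxx.
have : 1 + h * ((p h k k - 1) / h) @[h --> 0^'+] -->
    1 + 0 * batch_queue_generator lambda mu n k k.
  apply: cvgD; first exact: cvg_cst.
  apply: cvgM => //.
  exact: cvg_at_right_filter.
rewrite mul0r addr0; apply: cvg_trans; apply: near_eq_cvg; near=> h.
rewrite mulrC divfK ?subrKC//.
Unshelve. all: by end_near. Qed.

Variable f : nat -> R.
Hypothesis f_itv : forall j, 0 <= f j <= 1.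
Let u t k := series_mean (p t k) f.

Let u_itv (t : R) (k : nat) : 0 <= t -> 0 <= u t k <= 1.
Proof.
move=> t0; apply: series_mean_itv => //; last exact: transition_sum.
by move=> j; exact: transition_ge0.
Qed.

Let uD (s t : R) (k : nat) : 0 <= s -> 0 <= t ->
  u (s + t) k = series_mean (p s k) (u t).
Proof. by move=> s0 t0; exact: chapman_kolmogorov_mean. Qed.

Lemma mean_left_continuous (t : R) (k : nat) : 0 < t ->
  u s k @[s --> t^'-] --> u t k.
Proof.
move=> t0; apply/cvgrPdist_lt => e e0.
have /near_at_right0P[d d0 dP] : \forall h \near 0^'+, 1 - p h k k < e.
  have e1 : 1 - e < 1 by rewrite gtrBl.
  near=> h; rewrite ltrBlDr -ltrBlDl; near: h.
  exact: cvgr_gt _ (cvg_transition_diag k) _ e1.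
near=> s.
have s0 : 0 < s by near: s; exact: nbhs_left_gt.
have st : s < t by near: s; exact: nbhs_left_lt.
have tds : t - d < s by near: s; apply: nbhs_left_gt; rewrite gtrBl.
have h0 : 0 <= t - s by rewrite subr_ge0 ltW.
rewrite -[X in u X k](subrK s t) uD// ?(ltW s0)//.
apply: (@le_lt_trans _ _ (1 - p (t - s) k k)).
  apply: series_mean_near_value.
  - by move=> j; exact: transition_ge0.
  - exact: transition_sum.
  - by move=> j; apply: u_itv; exact: ltW.
by apply: dP; rewrite subr_gt0 st/= ltrBlDr -ltrBlDl.
Unshelve. all: by end_near. Qed.

(** Chapman-Kolmogorov expresses the increment of u over [t, t + h] as the mean of
    u(t, _) under p_h(k, _) minus u(t, k). The states reachable in one jump lie
    below N = k + n + 1; the states from N on carry the mass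
    1 - sum_(m < N) p_h(k, m), which is o(h) because the rows of the generator
    sum to 0. This squeezes the difference quotient between finite sums. *)
Lemma mean_backward_equation (t : R) (k : nat) : 0 <= t ->
  (u (t + h) k - u t k) / h @[h --> 0^'+] -->
  batch_queue_drift lambda mu n (u t) k.
Proof.
move=> t0; set N := (k + n).+1.
pose L (g : nat -> R) h := \sum_(0 <= m < N) (p h k m - (k == m)%:R) / h * g m.
have cvgL g : L g h @[h --> 0^'+] --> batch_queue_drift lambda mu n g k.
  rewrite -sum_batch_queue_generator.
  apply: cvg_big => [|m _]; first exact: add_continuous.
  by apply: cvgMl; exact: p_gen.
have LE g h : 0 < h ->
    L g h = ((\sum_(0 <= m < N) p h k m * g m) - g k) / h.
  move=> h0; rewrite /L.
  have -> : g k = \sum_(0 <= m < N) (k == m)%:R * g m.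
    under eq_bigr do rewrite mulr_natl mulrb eq_sym.
    by rewrite -big_mkcond/= big_nat1_eq ltnS leq_addr.
  rewrite -sumrB mulr_suml; apply: eq_bigr => m _; ring.
have drift1 : batch_queue_drift lambda mu n (fun=> 1) k = 0.
  rewrite /batch_queue_drift; ring.
apply: (@squeeze_cvgr _ _ _ _ (L (u t)) (fun h => L (u t) h - L (fun=> 1) h)).
- near=> h.
  have h0 : 0 < h by near: h; exact: nbhs_right_gt.
  have ph j := transition_ge0 p_tf k j (ltW h0).
  have ps := transition_sum p_tf k (ltW h0).
  have ui j := @u_itv t j t0.
  rewrite !LE// -mulrBl !ler_pM2r ?invr_gt0// (addrC t) uD// ?(ltW h0)//.
  rewrite lerD2r partial_sum_le_series_mean//=.
  have := series_mean_le_tail1 ph ps ui N.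
  have -> : \sum_(0 <= m < N) p h k m * 1 = \sum_(0 <= m < N) p h k m.
    by apply: eq_bigr => m _; rewrite mulr1.
  by lra.
- exact: cvgL.
- have -> : batch_queue_drift lambda mu n (u t) k =
      batch_queue_drift lambda mu n (u t) k -
      batch_queue_drift lambda mu n (fun=> 1) k by rewrite drift1 subr0.
  by apply: cvgB; exact: cvgL.
Unshelve. all: by end_near. Qed.

End backward_equation.

(** * Identification of the generating functions and passage to the limit *)

Lemma is_derive_right (R : realType) (g : R -> R) (t dg : R) :
  is_derive t (1 : R) g dg ->
  (g (t + h) - g t) / h @[h --> 0^'+] --> dg.
Proof.
move=> [dgt <-].
have gr : h^-1 *: (g (h *: 1 + t) - g t) @[h --> 0^'+] --> 'D_1 g t.
  exact: cvg_dnbhs_at_right.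
apply: cvg_trans gr; apply: near_eq_cvg; apply: nearW => h.
by rewrite /GRing.scale /= mulr1 mulrC (addrC t).
Qed.

Section transition_pgf.
Context (R : realType) (lambda mu : R) (n : nat) (p : R -> nat -> nat -> R).
Hypotheses (lambda_gt0 : 0 < lambda) (mu_gt0 : 0 < mu) (n_gt0 : (0 < n)%N).
Hypothesis p_tf : transition_function p.
Hypothesis p_gen : has_generator p (batch_queue_generator lambda mu n).

Let rho := lambda / mu.
Let rho_ge0 : 0 <= rho. Proof. by rewrite divr_ge0// ltW. Qed.

Lemma batch_queue_drift_sub (f g : nat -> R) (k : nat) :
  batch_queue_drift lambda mu n (fun m => f m - g m) k =
  batch_queue_drift lambda mu n f k - batch_queue_drift lambda mu n g k.
Proof. by rewrite /batch_queue_drift; ring. Qed.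

(** Uniqueness of bounded solutions: the maximum principle applies to the
    difference of the two solutions in both orders. *)
Lemma transition_pgfE (z t : R) (k : nat) : 0 <= z <= 1 -> 0 <= t ->
  series_mean (p t k) (fun j => z ^+ j) = queue_pgf lambda mu n z t k.
Proof.
move=> z01 t0; have [z0 z1] := andP z01.
have zj j : 0 <= z ^+ j <= 1 by rewrite exprn_ge0//= exprn_ile1.
pose u s m := series_mean (p s m) (fun j => z ^+ j).
pose v := queue_pgf lambda mu n z.
have lambda_ge0 := ltW lambda_gt0; have mu_ge0 := ltW mu_gt0.
have u_itv s m : 0 <= s -> 0 <= u s m <= 1.
  move=> s0; apply: series_mean_itv => //; last exact: transition_sum.
  by move=> j; exact: transition_ge0.
have v_itv s m : 0 <= s -> 0 <= v s m <= expR (rho * (harmonic_poly R n).[z]).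
  exact: queue_pgf_itv.
have uv0 m : u 0 m = v 0 m.
  have p0 := transition_ge0 p_tf m ^~ (lexx 0).
  have := series_mean_near_value p0 (transition_sum p_tf m (lexx 0)) zj m.
  rewrite transition0// eqxx subrr normr_le0 subr_eq0 => /eqP.
  by rewrite -(queue_pgf0 lambda mu n).
have ul s m : 0 < s -> u r m @[r --> s^'-] --> u s m.
  exact: mean_left_continuous.
have vl s m : 0 < s -> v r m @[r --> s^'-] --> v s m.
  move=> s0; apply: cvg_at_left_filter.
  have vC : {for s, continuous (v ^~ m)}.
    apply/differentiable_continuous/derivable1_diffP.
    by have [] := is_derive_queue_pgf lambda n mu_gt0 z s m.
  exact: vC.
have ur s m : 0 <= s -> (u (s + h) m - u s m) / h @[h --> 0^'+] -->
    batch_queue_drift lambda mu n (u s) m.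
  exact: mean_backward_equation.
have vr s m : 0 <= s -> (v (s + h) m - v s m) / h @[h --> 0^'+] -->
    batch_queue_drift lambda mu n (v s) m.
  by move=> s0; apply: (@is_derive_right _ (v ^~ m)); exact: is_derive_queue_pgf.
have sub_right (f g : R -> nat -> R) s m :
    (f (s + h) m - f s m) / h @[h --> 0^'+] -->
      batch_queue_drift lambda mu n (f s) m ->
    (g (s + h) m - g s m) / h @[h --> 0^'+] -->
      batch_queue_drift lambda mu n (g s) m ->
    ((f (s + h) m - g (s + h) m) - (f s m - g s m)) / h @[h --> 0^'+] -->
      batch_queue_drift lambda mu n (fun l => f s l - g s l) m.
  move=> fr gr; rewrite batch_queue_drift_sub.
  have -> : (fun h => (f (s + h) m - g (s + h) m - (f s m - g s m)) / h) =
      (fun h => (f (s + h) m - f s m) / h - (g (s + h) m - g s m) / h).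
    by apply/funext => h; ring.
  exact: cvgB.
apply/eqP; rewrite eq_le -subr_le0 -[X in _ && X]subr_le0; apply/andP; split.
- apply: (@backward_maximum_principle _ lambda mu n (fun s m => u s m - v s m) 1)
    => //.
  + move=> s m s0; have /andP[_ u1] := u_itv s m s0.
    by have /andP[v0 _] := v_itv s m s0; lra.
  + by move=> m; rewrite uv0 subrr.
  + by move=> s m s0; apply: cvgB; [exact: ul|exact: vl].
  + by move=> s m s0; apply: sub_right; [exact: ur|exact: vr].
- apply: (@backward_maximum_principle _ lambda mu n (fun s m => v s m - u s m)
    (expR (rho * (harmonic_poly R n).[z]))) => //.
  + move=> s m s0; have /andP[u0 _] := u_itv s m s0.
    by have /andP[_ v1] := v_itv s m s0; lra.
  + by move=> m; rewrite uv0 subrr.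
  + by move=> s m s0; apply: cvgB; [exact: vl|exact: ul].
  + by move=> s m s0; apply: sub_right; [exact: vr|exact: ur].
Qed.

End transition_pgf.

(** Continuity theorem for generating functions, in which A t and B are known only
    through the bounds by partial sums. By induction on j: once the
    earlier coefficients converge, comparing the partial sums of length j + 1
    gives limsup |a_t(j) - b_j| z^j <= z^(j + 1), that is
    limsup |a_t(j) - b_j| <= z, for every z > 0. *)
Lemma pgf_continuity (R : realType) (a : R -> nat -> R) (b : nat -> R)
    (A : R -> R -> R) (B : R -> R) :
  (forall t z N, 0 <= t -> 0 <= z <= 1 ->
    \sum_(0 <= j < N) a t j * z ^+ j <= A t z <=
      \sum_(0 <= j < N) a t j * z ^+ j + z ^+ N) ->
  (forall z N, 0 <= z <= 1 ->
    \sum_(0 <= j < N) b j * z ^+ j <= B z <=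
      \sum_(0 <= j < N) b j * z ^+ j + z ^+ N) ->
  (forall z, 0 <= z <= 1 -> A t z @[t --> +oo] --> B z) ->
  forall j, a t j @[t --> +oo] --> b j.
Proof.
move=> Aa Bb AB j; elim/ltn_ind: j => j IH.
apply/cvgrPdist_lt => e e0; pose z := Num.min 1 (e / 2).
have z0 : 0 < z by rewrite lt_min ltr01 divr_gt0.
have z01 : 0 <= z <= 1 by rewrite ltW//= ge_min lexx.
have ze : z <= e / 2 by rewrite ge_min lexx orbT.
have zj0 : 0 < z ^+ j by rewrite exprn_gt0.
have lower : \sum_(l < j) (a t l - b l) * z ^+ l @[t --> +oo] -->
    \sum_(l < j) 0 * z ^+ l.
  apply: cvg_big => [|l _]; first exact: add_continuous.
  by apply: cvgMl; rewrite -(subrr (b l)); apply: cvgB;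
     [exact: IH|exact: cvg_cst].
have gap : (A t z - B z) - (\sum_(l < j) (a t l - b l) * z ^+ l)
    @[t --> +oo] --> (B z - B z) - \sum_(l < j) 0 * z ^+ l.
  by apply: cvgB lower; apply: cvgB; [exact: AB|exact: cvg_cst].
have ez : 0 < z ^+ j * (e / 2) by rewrite mulr_gt0// divr_gt0.
move/cvgrPdist_lt : gap => /(_ _ ez) near0.
near=> t.
have t0 : 0 <= t by near: t; exact: nbhs_pinfty_ge.
have /andP[lo hi] := Aa t z j.+1 t0 z01.
have /andP[lo' hi'] := Bb z j.+1 z01.
have : `|0 - ((A t z - B z) - \sum_(l < j) (a t l - b l) * z ^+ l)| <
    z ^+ j * (e / 2) by near: t;
  move: near0; rewrite subrr big1 ?subr0// => l _; rewrite mul0r.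
rewrite -(big_mkord xpredT (fun l => (a t l - b l) * z ^+ l)).
have -> : \sum_(0 <= l < j) (a t l - b l) * z ^+ l =
    \sum_(0 <= l < j) a t l * z ^+ l - \sum_(0 <= l < j) b l * z ^+ l.
  by rewrite -sumrB; apply: eq_bigr => l _; rewrite mulrBl.
have zj1 : z ^+ j.+1 <= z ^+ j * (e / 2) by rewrite exprSr ler_pM2l.
move: lo hi lo' hi'; rewrite !big_nat_recr//=.
rewrite sub0r normrN !ltr_norml => lo hi lo' hi' /andP[near1 near2].
by rewrite -(ltr_pM2l zj0) -(ltr_pM2l zj0 _ e); apply/andP; split; lra.
Unshelve. all: by end_near. Qed.

(** Dominated convergence for means of functions with values in [0, 1]: a finite
    part carries all the mass of w but e / 2. *)
Lemma cvg_series_mean (R : realType) (w : nat -> R) (f : R -> nat -> R) (l : R) :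
  (forall i, 0 <= w i) -> (\sum_(0 <= i <oo) (w i)%:E = 1)%E ->
  (forall t i, 0 <= t -> 0 <= f t i <= 1) -> 0 <= l <= 1 ->
  (forall i, f t i @[t --> +oo] --> l) ->
  series_mean w (f t) @[t --> +oo] --> l.
Proof.
move=> w0 w1 f01 l01 fl; apply/cvgrPdist_lt => e e0.
have [N wN] : exists N, 1 - \sum_(0 <= i < N) w i < e / 2.
  have : (\sum_(0 <= i < N) (w i)%:E)%E @[N --> \oo] --> 1%E.
    by rewrite -w1; apply: is_cvg_nneseries => i _ _; rewrite lee_fin.
  under eq_fun do rewrite sumEFin.
  move=> /fine_cvgP[_ /cvgrPdist_lt/(_ (e / 2))].
  rewrite divr_gt0// => /(_ isT)[N _ /(_ N (leqnn N))] /= dN.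
  by exists N; apply: le_lt_trans dN; exact: ler_norm.
have part : \sum_(0 <= i < N) w i * f t i @[t --> +oo] -->
    \sum_(0 <= i < N) w i * l.
  by apply: cvg_big => [|i _]; [exact: add_continuous|exact: cvgMr].
move/cvgrPdist_lt : part => /(_ (e / 2)) /=.
rewrite divr_gt0// => /(_ isT) near0.
near=> t; have t0 : 0 <= t by near: t; exact: nbhs_pinfty_ge.
have : `|\sum_(0 <= i < N) w i * l - \sum_(0 <= i < N) w i * f t i| < e / 2.
  by near: t; exact: near0.
have lo := partial_sum_le_series_mean w0 w1 (f01 t ^~ t0) N.
have hi := series_mean_le_tail1 w0 w1 (f01 t ^~ t0) N.
have s1 := partial_sum_le1 w0 w1 N.
rewrite -mulr_suml; move: lo hi s1 wN; set s := \sum_(0 <= i < N) w i.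
move: l01 => /andP[l0 l1] lo hi s1 wN.
by rewrite !ltr_norml => /andP[n1 n2]; apply/andP; split; nra.
Unshelve. all: by end_near. Qed.

Lemma discrete_probability (R : realType) (a : nat -> R) :
  (forall j, 0 <= a j) -> (\sum_(0 <= j <oo) (a j)%:E = 1)%E ->
  exists nu : probability nat R, forall j, nu [set j] = (a j)%:E.
Proof.
move=> a0 a1.
pose m : {measure set nat -> \bar R} :=
  mseries (fun k => mscale (NngNum (a0 k)) (\d_k : {measure set nat -> \bar R})) 0.
have mE A : m A = (\sum_(0 <= k <oo) (a k * (k \in A)%:R)%:E)%E.
  by apply: eq_eseriesr => k _; rewrite /mscale/=.
have mT : m setT = 1%E.
  by rewrite mE -a1; apply: eq_eseriesr => k _; rewrite in_setT mulr1.
pose mP := Measure_isProbability.Build _ _ R m mT.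
exists (HB.pack_for (probability nat R) (Measure.sort m) mP) => j.
rewrite -[LHS]/(m [set j]) mE (nneseriesD1 (n := j))//.
  rewrite in_set1 eqxx mulr1 eseries0 ?adde0// => k _ /= kj.
  by rewrite in_set1 (negbTE kj) mulr0.
by move=> k _; rewrite lee_fin mulr_ge0.
Qed.

(** * The limiting distribution *)

Section recursion_weight_law.
Context (R : realType) (rho : R) (n : nat).
Hypothesis rho_ge0 : 0 <= rho.

(** The value at z = 1 of the generating function, where F(1) = exp 0. *)
Lemma recursion_weight_sum :
  (\sum_(0 <= j <oo) (recursion_weight rho n j)%:E = 1)%E.
Proof.
have := @cvg_weight_poly _ _ n rho_ge0 1.
rewrite ler01 lexx => /(_ isT); rewrite subrr mulr0 expR0 => S1.
apply/cvg_lim => //; apply: cvg_EFin.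
  by apply: nearW => N; rewrite sumEFin.
apply: cvg_trans S1; apply: near_eq_cvg; apply: nearW => N.
rewrite /= sumEFin /= horner_weight_poly.
by apply: eq_bigr => j _; rewrite expr1n mulr1.
Qed.

Lemma recursion_weight_le1 (j : nat) : recursion_weight rho n j <= 1.
Proof.
apply: le_trans (@weight_poly1_le1 _ _ n rho_ge0 j.+1).
rewrite horner_weight_poly big_nat_recr//= expr1n mulr1 lerDr sumr_ge0// => l _.
by rewrite mulr_ge0 ?exprn_ge0 ?recursion_weight_ge0.
Qed.

End recursion_weight_law.

Section limit_law.
Context (R : realType) (lambda mu : R) (n : nat) (p : R -> nat -> nat -> R).
Hypotheses (lambda_gt0 : 0 < lambda) (mu_gt0 : 0 < mu) (n_gt0 : (0 < n)%N).
Hypothesis p_tf : transition_function p.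
Hypothesis p_gen : has_generator p (batch_queue_generator lambda mu n).

Let rho := lambda / mu.
Let rho_ge0 : 0 <= rho. Proof. by rewrite divr_ge0// ltW. Qed.

Lemma cvg_transition (i j : nat) :
  p t i j @[t --> +oo] --> recursion_weight rho n j.
Proof.
apply: (@pgf_continuity _ (fun t => p t i) (recursion_weight rho n)
  (fun t z => series_mean (p t i) (fun l => z ^+ l))
  (fun z => expR (rho * ((harmonic_poly R n).[z] - (harmonic_poly R n).[1])))).
- move=> t z N t0 /andP[z0 z1].
  have zl l : 0 <= z ^+ l <= 1 by rewrite exprn_ge0//= exprn_ile1.
  have pt l := transition_ge0 p_tf i l t0.
  have ps := transition_sum p_tf i t0.
  rewrite partial_sum_le_series_mean//=.
  apply: le_trans (series_mean_le_tail (N := N) (c := z ^+ N) pt ps zl _ _) _.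
  + by rewrite exprn_ge0.
  + by move=> l Nl; rewrite ler_wiXn2l.
  + by rewrite lerD2l ler_piMr ?exprn_ge0// gerBl sumr_ge0.
- move=> z N z01; rewrite -horner_weight_poly.
  by rewrite weight_poly_le//= le_weight_poly.
- move=> z z01.
  apply: cvg_trans (@cvg_queue_pgf _ lambda _ n mu_gt0 z i).
  apply: near_eq_cvg; near=> t.
  rewrite (transition_pgfE lambda_gt0 mu_gt0 n_gt0)//.
Unshelve. all: by end_near. Qed.

End limit_law.

Section mixture.
Context (R : realType) (d : measure_display) (Omega : measurableType d).
Context (P : probability Omega R) (Q : R -> {RV P >-> nat}).

Let mQ (t : R) (i : nat) : measurable [set w | Q t w = i].
Proof. exact: (@measurable_funPTI _ _ _ _ (Q t) [set i] I). Qed.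

Lemma total_probability (t : R) (E : set Omega) : measurable E ->
  (P E = \sum_(0 <= i <oo) P ([set w | Q t w = i] `&` E))%E.
Proof.
move=> mE; rewrite -measure_semi_bigcup//.
- congr (P _); apply/seteqP; split=> [w Ew|w [i _ []]//].
  by exists (Q t w).
- by move=> i; apply: measurableI.
- by apply/trivIsetP => i j _ _ ij; apply/seteqP; split=> // w;
     move=> [[/= Qi _] [/= Qj _]]; move: ij; rewrite -Qi -Qj eqxx.
- by apply: bigcup_measurable => i _; exact: measurableI.
Qed.

Let initial (i : nat) : R := fine (P [set w | Q 0 w = i]).

Let initialE (i : nat) : (initial i)%:E = P [set w | Q 0 w = i].
Proof. by rewrite fineK// fin_num_measure. Qed.

(** Conditioning on the initial state: the Markov property with an empty past at
    time 0 makes P(Q_t = j) the mean of p_t(_, j) under the initial law. *)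
Lemma cvg_markov_distribution (p : R -> nat -> nat -> R) (r : nat -> R)
    (j : nat) :
  transition_function p -> markov_property Q p ->
  0 <= r j <= 1 -> (forall i, p t i j @[t --> +oo] --> r j) ->
  distribution P (Q t) [set j] @[t --> +oo] --> (r j)%:E.
Proof.
move=> p_tf p_markov rj pr.
have initial_ge0 i : 0 <= initial i by rewrite fine_ge0.
have initial_sum : (\sum_(0 <= i <oo) (initial i)%:E = 1)%E.
  rewrite -(probability_setT P) (total_probability 0 measurableT).
  by apply: eq_eseriesr => i _; rewrite initialE setIT.
have p_itv t i : 0 <= t -> 0 <= p t i j <= 1.
  by move=> t0; rewrite transition_ge0//= transition_le1.
have law t : 0 <= t ->
    distribution P (Q t) [set j] = (series_mean initial (fun i => p t i j))%:E.
  move=> t0; rewrite -series_meanE//; last by move=> i; exact: p_itv.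
  rewrite -probability_distribution (total_probability 0 (mQ t j)).
  apply: eq_eseriesr => i _.
  have := p_markov [::] 0 t i j (lexx 0) t0 isT.
  rewrite /= add0r (_ : [set _ | true] = setT) ?setTI; last by apply/seteqP.
  by move=> ->; rewrite EFinM initialE.
have := cvg_series_mean initial_ge0 initial_sum p_itv rj pr => m.
apply: cvg_trans; last by apply: (cvg_comp _ EFin m); exact: cvg_id.
apply: near_eq_cvg; near=> t; rewrite law//.
Unshelve. all: by end_near. Qed.

End mixture.

Theorem proposition2p5 (R : realType) (lambda mu : R) (n : nat)
    (d : measure_display) (Omega : measurableType d) (P : probability Omega R)
    (Q : R -> {RV P >-> nat})
    (lambda_gt0 : 0 < lambda) (mu_gt0 : 0 < mu) (n_gt0 : (0 < n)%N)
    (Q_ctmc : continuous_time_markov_chain Q (batch_queue_generator lambda mu n)) :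
  exists nu : probability nat R,
    limiting_distribution Q nu /\
    let p := point_prob nu in
    [/\ forall j : nat, (1 <= j)%N ->
          p j%:Z = \sum_(1 <= i < n.+1)
                     i%:R * p (j%:Z - i%:Z) * (lambda / (i%:R * j%:R * mu)) /\
          \sum_(1 <= i < n.+1)
             i%:R * p (j%:Z - i%:Z) * (lambda / (i%:R * j%:R * mu)) =
          \sum_(1 <= i < n.+1) p (j%:Z - i%:Z) * (lambda / (j%:R * mu)),
        p 0 = expR (- (lambda / mu) * harmonic_number R n)
      & forall k : int, k < 0 -> p k = 0 ].
Proof.
have [p [p_tf p_gen p_markov]] := Q_ctmc.
pose rho := lambda / mu.
have rho_ge0 : 0 <= rho by rewrite divr_ge0// ltW.
pose r := recursion_weight rho n.
have r_ge0 j : 0 <= r j by exact: recursion_weight_ge0.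
have [nu nuE] := discrete_probability r_ge0 (recursion_weight_sum n rho_ge0).
exists nu; split=> [j|].
  rewrite nuE; apply: (cvg_markov_distribution p_tf p_markov) => [|i].
    by rewrite r_ge0 recursion_weight_le1.
  exact: cvg_transition.
have pos (j : nat) : point_prob nu j%:Z = r j.
  rewrite /point_prob (_ : [set _ | _] = [set j]) ?nuE//.
  by apply/seteqP; split=> [q [] //|q ->].
have neg (k : int) : k < 0 -> point_prob nu k = 0.
  move=> k0; rewrite /point_prob (_ : [set _ | _] = set0) ?measure0//.
  by apply/seteqP; split=> // q /= qk; move: k0; rewrite -qk.
split=> // [j j1|]; last exact: (pos 0%N).
have sumE : \sum_(1 <= i < n.+1)
    i%:R * point_prob nu (j%:Z - i%:Z) * (lambda / (i%:R * j%:R * mu)) =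
    \sum_(1 <= i < n.+1) point_prob nu (j%:Z - i%:Z) * (lambda / (j%:R * mu)).
  rewrite big_nat_cond [RHS]big_nat_cond; apply: eq_bigr => i.
  move=> /andP[/andP[i1 _] _]; field.
  by rewrite !pnatr_eq0 -!lt0n i1 j1 gt_eqF.
split=> //; rewrite sumE pos /r recursion_weightS// mulr_sumr big_mkcond.
apply: eq_bigr => i _; case: leqP => ij.
  rewrite subzn// pos /rho mulrC; congr (_ * _).
  by field; rewrite pnatr_eq0 -lt0n j1 gt_eqF.
by rewrite neg ?mul0r// subr_lt0 ltz_nat.
Qed.
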